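(* For any hyperbolic polynomial $x\mapsto x^2+c$ with $c\in\mathcal{M}$, there exist $a\in\mathbb{C}$, $R>6$ and $S>0$ such that for $$f(z,w)=(p(z),q_z(w))=\left(z^2-R,\; w^2+c+\frac{z+a}{S}\right)$$ we have: (1) $J_p\subset D_1\cup D_2$, for the intervals $D_1=[-\beta,-\eta]$ and $D_2=-D_1$, where $\beta>0>\alpha$ are the fixed points of $p$, and $\eta=\sqrt{R-\beta}$; (2) for all $z\in D_1$, $q_z$ is in the same hyperbolic component of $\mathcal{M}$ as $c$ (hence $q_z(w)$ is topologically conjugate to $w^2+c$); and (3) for all $z\in D_2$, $q_z$ is outside of $\mathcal{M}$.
   Context: $\mathcal{M}$ denotes the Mandelbrot set for quadratic polynomials: the set of all $c\in\mathbb{C}$ such that the orbit of the critical point $0$ under $x\mapsto x^2+c$ is bounded (equivalently, the Julia set of $x\mapsto x^2+c$ is connected). A polynomial map of $\mathbb{C}$ is called hyperbolic if it is uniformly expanding on some neighborhood of its Julia set, with respect to some Riemannian metric. A hyperbolic component of $\mathcal{M}$ is a connected component of the set of those $c\in\mathcal{M}$ for which $x\mapsto x^2+c$ is hyperbolic. The map $f$ is a polynomial skew product of $\mathbb{C}^2$, i.e. a map of the form $f(z,w)=(p(z),q(z,w))$, where $p$ and $q$ are polynomials of the same degree $d\ge 2$; one writes $q_z(w)=q(z,w)$. $J_p\subset\mathbb{C}$ denotes the Julia set of the one-variable polynomial $p$ (the topological boundary of the set of points with bounded orbit under $p$). A quadratic polynomial $w\mapsto w^2+c'$ is identified with its parameter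 $c'$; thus ''$q_z$ is in a hyperbolic component of $\mathcal{M}$'' or ''$q_z$ is outside of $\mathcal{M}$'' refers to the parameter $c'=c+\frac{z+a}{S}$.
   Formalization: In (2), ''topologically conjugate'' is stated as conjugacy on the Julia sets; conjugacy on all of C fails, e.g. for c=0, since w^2 fixes its critical point while w^2+c' with c'≠0 does not, and the interval D_1 always yields some c'≠0. *)

(* Defs.v *)
From HB Require Import structures.
From mathcomp Require Import all_boot all_order all_algebra.
From mathcomp Require Import all_classical all_reals all_analysis.
From mathcomp Require Import complex.
Set Implicit Arguments.
Unset Strict Implicit.
Unset Printing Implicit Defensive.
Import Order.TTheory GRing.Theory Num.Theory.
Import numFieldNormedType.Exports.
Local Open Scope complex_scope.
Local Open Scope classical_set_scope.
Local Open Scope ring_scope.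

(* The complex numbers K[i] get the topology of the complex modulus; the norm
   `|z| : K[i] is the modulus, seen as a complex number. *)
HB.instance Definition _ (K : rcfType) := NormedModule.copy K[i] K[i]^o.

Definition bounded_orbit (K : realType) (f : {poly K[i]}) (z : K[i]) : Prop :=
  bounded_set (range (fun n : nat => iter n (horner f) z)).

Definition julia (K : realType) (f : {poly K[i]}) : set K[i] :=
  let filled := [set z | bounded_orbit f z] in
  closure filled `\` interior filled.

Definition quad (K : realType) (c : K[i]) : {poly K[i]} := 'X^2 + c%:P.

Definition mandelbrot (K : realType) : set K[i] :=
  [set c | bounded_orbit (quad c) 0].

(* Real directional derivative of h : C = R^2 -> R along v. *)
Definition dir_deriv (K : realType) (v : K[i]) (h : K[i] -> K) (z : K[i]) : K :=
  derive1 (fun t : K => h (z + t%:C * v)) 0.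

(* Class C^n, in the real sense, on the open set V. *)
Fixpoint class_C (K : realType) (n : nat) (V : set K[i]) (h : K[i] -> K) :
    Prop :=
  (forall z, V z -> {for z, continuous h}) /\
  if n is m.+1 then
    forall v : K[i],
      (forall z, V z -> derivable (fun t : K => h (z + t%:C * v)) 0 1) /\
      class_C m V (dir_deriv v h)
  else True.

Definition smooth_on (K : realType) (V : set K[i]) (h : K[i] -> K) : Prop :=
  forall n, class_C n V h.

(* g z is an inner product on the real tangent space of C = R^2 at z; the
   metric is arbitrary, not necessarily conformal. *)
Definition riemannian_metric (K : realType) (V : set K[i])
    (g : K[i] -> K[i] -> K[i] -> K) : Prop :=
  [/\ forall v w, smooth_on V (fun z => g z v w),
      forall z v w, V z -> g z v w = g z w v,
      forall z (t : K) u v w, V z ->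
        g z (t%:C * u + v) w = t * g z u w + g z v w
    & forall z v, V z -> v != 0 -> 0 < g z v v].

Definition metric_norm (K : realType) (g : K[i] -> K[i] -> K[i] -> K)
    (z v : K[i]) : K := Num.sqrt (g z v v).

(* f is uniformly expanding on N for the metric g, which lives on a set V
   containing both N and f(N) so that the norms at z and f(z) make sense. *)
Definition uniformly_expanding (K : realType) (f : {poly K[i]})
    (N V : set K[i]) (g : K[i] -> K[i] -> K[i] -> K) : Prop :=
  [/\ N `<=` V, (horner f) @` N `<=` V &
    exists2 k : K, 1 < k & forall z v, N z ->
      k * metric_norm g z v <= metric_norm g f.[z] (f^`().[z] * v)].

Definition hyperbolic (K : realType) (f : {poly K[i]}) : Prop :=
  exists (N V : set K[i]) (g : K[i] -> K[i] -> K[i] -> K),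
    [/\ open N, julia f `<=` N, open V, riemannian_metric V g
      & uniformly_expanding f N V g].

Definition hyperbolic_locus (K : realType) : set K[i] :=
  [set c | mandelbrot c /\ hyperbolic (quad c)].

Definition hyperbolic_component (K : realType) (W : set K[i]) : Prop :=
  exists2 c, hyperbolic_locus c & W = connected_component (@hyperbolic_locus K) c.

(* Topological conjugacy of polynomials on their Julia sets: h is a
   homeomorphism from julia f onto julia g, with inverse h'.  On all of C it
   would fail inside a hyperbolic component: a conjugacy preserves critical
   points, so x^2 (fixed critical point) is not conjugate to x^2 + c with
   c <> 0 small. *)
Definition conjugate_on_julia (K : realType) (f g : {poly K[i]}) : Prop :=
  exists h h' : K[i] -> K[i],
    [/\ {within julia f, continuous h},
        {within julia g, continuous h'},
        forall z, julia f z -> julia g (h z) /\ h' (h z) = z,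
        forall w, julia g w -> julia f (h' w) /\ h (h' w) = w
      & forall z, julia f z -> h f.[z] = g.[h z]].

(* Main.v *)
Require Import Defs.
From HB Require Import structures.
From mathcomp Require Import all_boot all_order all_algebra.
From mathcomp Require Import all_classical all_reals all_analysis.
From mathcomp Require Import complex.
From mathcomp Require Import ring lra.
Set Implicit Arguments.
Unset Strict Implicit.
Unset Printing Implicit Defensive.
Import Order.TTheory GRing.Theory Num.Theory.
Import numFieldNormedType.Exports.
Local Open Scope complex_scope.
Local Open Scope classical_set_scope.
Local Open Scope ring_scope.
Import ComplexField.Normc.

(** The parameter of [q_z] depends affinely on [z], and the Julia set of
    [p = z^2 - R] sits in two intervals: [D1], of length at most [2], and its
    mirror image [D2], at distance about [2 sqrt R] from it.  Fix [S] so large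
    that [c + t] is a small perturbation of [c] for [0 <= t <= 2 / S], and only
    then [R], with [a = beta], so large that over [D2] the parameter leaves the
    disc that contains the Mandelbrot set.  What has to be proved is that [p] has
    a real Julia set ([filled_real]) and that hyperbolic parameters are
    structurally stable ([structural_stability]): for [t] close to [c], the map
    [x^2 + t] is again hyperbolic with bounded critical orbit, and it is conjugate
    to [x^2 + c] on the Julia sets.  The real segment from [c] to [c + 2 / S] is
    then a connected subset of the hyperbolic locus.

    The Julia set of [p] is real because a point [z] with bounded orbit has
    [|Re z| >= sqrt (R - beta) > 1], as does every point of its orbit, while one
    step multiplies [Im z] by [2 Re z].

    Structural stability avoids complex analysis by using two special features
    of the situation.  Since [f x = x^2 + c] is conformal, averaging an expanded Riemannian
    metric over the rotations of each tangent plane yields an expanded conformal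
    metric [rho(z) |dz|] ([hyperbolic_mean_norm]).  And since
    [f x - f z = (x - z) (x + z)], expansion at a point becomes expansion of
    nearby distances, with constants that compactness makes uniform near the
    Julia set [J_c] ([hyperbolic_expanding]).  From there:

    - Persistence.  A tube around [J_c] contains its preimage under [f_t] for [t]
      near [c].  Hence points of the filled Julia set of [f_c] outside the tube
      keep bounded orbits under [f_t], the critical point [0] among them; points
      outside both escape.  So [J_t] lies in the tube ([persistence]).

    - Characterization.  Conversely a point whose [f_t]-orbit stays near [J_c]
      belongs to [J_t]: small discs around it are blown up until they contain
      escaping points ([near_orbit_jset]).

    - Shadowing.  Pulling back along an orbit of [f_s] that stays near [J_c], with
      the inverse branches of [f_t], contracts; this yields an orbit of [f_t] that
      follows it forever ([shadowing]).  By expansion it is unique, so the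
      correspondence between [J_s] and [J_t] is a conjugacy
      ([conjugate_of_shadowing]).  *)

(** * The modulus and compactness in the complex plane *)

Section Modulus.
Variable K : realType.
Implicit Types (z w : K[i]) (e r : K).

Lemma norm_normc z : `|z| = (normc z)%:C.
Proof. by case: z => a b; rewrite normc_def. Qed.

Lemma normc_ge0 z : 0 <= normc z.
Proof. by case: z => a b /=; exact: sqrtr_ge0. Qed.

Lemma normc_gt0 z : z != 0 -> 0 < normc z.
Proof.
move=> z0; rewrite lt_neqAle normc_ge0 andbT eq_sym.
by apply: contra z0 => /eqP/eq0_normc ->.
Qed.

Lemma normc_distC z w : normc (z - w) = normc (w - z).
Proof. by rewrite -opprB normcN. Qed.

Lemma normc_triangle z u w : normc (z - w) <= normc (z - u) + normc (u - w).
Proof. by rewrite (le_trans _ (le_normcD _ _)) // addrA subrK. Qed.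

Lemma normc_real (x : K) : normc x%:C = `|x|.
Proof. by rewrite /= expr0n addr0 sqrtr_sqr. Qed.

Lemma normcX z n : normc (z ^+ n) = normc z ^+ n.
Proof. by elim: n => [|n IH]; rewrite ?expr0 ?normc1 // !exprS normcM IH. Qed.

Lemma normc_Re_le z : `|complex.Re z| <= normc z.
Proof. by case: z => a b /=; rewrite -sqrtr_sqr ler_wsqrtr// lerDl sqr_ge0. Qed.

Lemma normc_Im_le z : `|complex.Im z| <= normc z.
Proof. by case: z => a b /=; rewrite -sqrtr_sqr ler_wsqrtr// lerDr sqr_ge0. Qed.

Lemma normc_sqr z : normc z ^+ 2 = complex.Re z ^+ 2 + complex.Im z ^+ 2.
Proof. by case: z => a b /=; rewrite sqr_sqrtr // addr_ge0 ?sqr_ge0. Qed.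

Lemma normc_le_add (a b : K) : normc (a +i* b) <= `|a| + `|b|.
Proof.
rewrite -(@ler_pXn2r _ 2) ?nnegrE ?normc_ge0 ?addr_ge0 //.
rewrite normc_sqr /= -[a ^+ 2]real_normK ?num_real // -[b ^+ 2]real_normK ?num_real //.
have := normr_ge0 a; have := normr_ge0 b; nra.
Qed.

Lemma sqrt_exists z : exists w, w ^+ 2 = z.
Proof. by exists (sqrtc z); rewrite sqr_sqrtc. Qed.

Lemma nbhs_normcP z (A : set K[i]) :
  nbhs z A <-> exists2 e, 0 < e & forall w, normc (w - z) < e -> A w.
Proof.
split.
  move=> /nbhs_ballP [[e e']]; rewrite /= ltcE /= => /andP[/eqP -> e0] H.
  exists e => // w we; apply: H; rewrite -ball_normE /= distrC norm_normc.
  by rewrite -[X in _ < X]/(e%:C) ltcR.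
case=> e e0 H; apply/nbhs_ballP; exists e%:C => /=; first by rewrite ltcR.
by move=> w; rewrite -ball_normE /= distrC norm_normc ltcR; apply: H.
Qed.

Lemma bounded_rangeP (u : nat -> K[i]) :
  bounded_set (range u) <-> exists M, forall n, normc (u n) <= M.
Proof.
have PF : ProperFilter (globally (range u)).
  by apply: (@globally_properfilter _ _ (u 0%N)); exists 0%N.
split=> [/ex_bound [M H]|[M H]].
  exists (complex.Re M) => n.
  have : `|u n| <= M by apply: H; exists n.
  by rewrite norm_normc lecE /= => /andP[].
by apply/ex_bound; exists M%:C => _ [n _ <-] /=; rewrite norm_normc lecR.
Qed.

Lemma open_normcP (A : set K[i]) :
  open A <-> forall z, A z -> exists2 e, 0 < e & forall w, normc (w - z) < e -> A w.
Proof.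
rewrite openE; split=> H z Az; first by apply/nbhs_normcP; exact: H.
by apply/nbhs_normcP; exact: H.
Qed.

Lemma closed_disc_compact r : compact [set z | normc z <= r].
Proof.
have cs : compact [set z : K[i] | `|complex.Re z| <= r /\ `|complex.Im z| <= r].
  have -> : [set z : K[i] | `|complex.Re z| <= r /\ `|complex.Im z| <= r] =
      (fun p : K * K => p.1 +i* p.2) @` (`[- r, r] `*` `[- r, r]).
    apply/seteqP; split=> [[a b] /= [ha hb]|_ [[a b] /= [ha hb] <-] /=].
      by exists (a, b) => //=; rewrite !in_itv /= -!ler_norml.
    by rewrite !ler_norml; move: ha hb; rewrite !in_itv /=.
  apply: continuous_compact; last by apply: compact_setX; exact: segment_compact.
  apply: continuous_subspaceT => -[a b] A /nbhs_normcP[e e0 H].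
  apply/nbhs_ballP; exists (e / 2); first by rewrite /= divr_gt0.
  move=> [a' b'] [] /=; rewrite -!ball_normE /= => ha hb; apply: H => /=.
  rewrite (le_lt_trans (normc_le_add _ _)) // distrC [`|b' - b|]distrC; lra.
apply: subclosed_compact cs _; last first.
  by move=> z /= zr; split; rewrite (le_trans _ zr) ?normc_Re_le ?normc_Im_le.
rewrite -openC; apply/open_normcP => z /= /negP; rewrite -ltNge => rz.
exists (normc z - r) => [|w wz]; first lra.
apply/negP; rewrite -ltNge.
have := normc_triangle z w 0; rewrite !subr0 normc_distC; lra.
Qed.

(** Stated with a cluster point instead of a convergent subsequence, which is all that
    the arguments below extract from it. *)
Lemma bolzano_weierstrass (u : nat -> K[i]) r : (forall n, normc (u n) <= r) ->
  exists z, forall e, 0 < e -> forall N, exists2 n, (N <= n)%N & normc (u n - z) < e.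
Proof.
move=> ur.
have PF : ProperFilter (u @ \oo) by exact: fmap_proper_filter.
have Fr : (u @ \oo) [set z | normc z <= r] by exists 0%N => // n _; exact: ur.
have [z [_ zc]] := closed_disc_compact PF Fr.
exists z => e e0 N.
have [||w [[n /= Nn <-] wz]] := zc (u @` [set n | (N <= n)%N]) [set w | normc (w - z) < e].
- by exists N => // n /= Nn; exists n.
- by apply/nbhs_normcP; exists e.
by exists n.
Qed.

(** A Lebesgue number lemma: it turns every pointwise choice of a scale below into
    a uniform one.  Otherwise points [u n] that fail at scale [1 / (n + 1)] would
    cluster at a point of [A], where some scale works nearby. *)
Lemma compact_uniform (A : set K[i]) (P : K[i] -> K -> Prop) r :
  (forall z, A z -> normc z <= r) ->
  (forall z, (forall e, 0 < e -> exists2 w, A w & normc (w - z) < e) -> A z) ->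
  (forall z d e, 0 < d -> d <= e -> P z e -> P z d) ->
  (forall z, A z -> exists2 e, 0 < e & forall w, A w -> normc (w - z) < e -> P w e) ->
  exists2 e, 0 < e & forall z, A z -> P z e.
Proof.
move=> Ar Acl Panti Ploc; apply: contrapT => noe.
have /choice[u uP] : forall n : nat, exists z, A z /\ ~ P z n.+1%:R^-1.
  move=> n; apply: contrapT => H; apply: noe; exists n.+1%:R^-1 => [|z Az].
    by rewrite invr_gt0.
  by apply: contrapT => nP; apply: H; exists z.
have [|z zu] := @bolzano_weierstrass u r; first by move=> n; apply: Ar; case: (uP n).
have Az : A z.
  by apply: Acl => e e0; have [n _ nz] := zu _ e0 0%N; exists (u n) => //; case: (uP n).
have [e e0 Pe] := Ploc _ Az.
have [N Ne] : exists N : nat, N.+1%:R^-1 <= e.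
  exists (Num.truncn e^-1).
  by rewrite invf_ple ?posrE // ltW // truncnS_gt.
have [n Nn nz] := zu _ e0 N.
have [Aun []] := uP n; apply: (Panti _ _ e); last exact: Pe.
  by rewrite invr_gt0.
by rewrite (le_trans _ Ne) // lef_pV2 ?posrE // ler_nat ltnS.
Qed.

End Modulus.

(** * Quadratic maps, filled Julia sets and Julia sets *)

Section Dynamics.
Variable K : realType.
Implicit Types (z w c x y u : K[i]) (d e r : K).

Definition qmap c z := z ^+ 2 + c.
Definition orbit c n z := iter n (qmap c) z.
Definition filled c : set K[i] :=
  [set z | exists M, forall n, normc (orbit c n z) <= M].
(** The Julia set of the quadratic polynomial ([juliaP]).  As the filled Julia set is
    closed, its boundary consists of its points that are limits of escaping points. *)
Definition jset c : set K[i] :=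
  [set z | filled c z /\
    forall e, 0 < e -> exists2 w, normc (w - z) < e & ~ filled c w].

Lemma horner_quad c : horner (quad c) = qmap c.
Proof. by apply/funext => z; rewrite /quad !hornerE. Qed.

Lemma deriv_quad c z : (quad c)^`().[z] = z + z.
Proof. by rewrite /quad derivD derivC addr0 derivXn /= !hornerE. Qed.

Lemma bounded_orbitP c z : bounded_orbit (quad c) z <-> filled c z.
Proof. by rewrite /bounded_orbit bounded_rangeP horner_quad. Qed.

Lemma mandelbrotP c : mandelbrot c <-> filled c 0.
Proof. exact: bounded_orbitP. Qed.

Lemma qmapB c c' z w : qmap c z - qmap c' w = (z - w) * (z + w) + (c - c').
Proof. by rewrite /qmap; ring. Qed.

Lemma normc_qmapB c z w :
  normc (qmap c z - qmap c w) = normc (z - w) * normc (z + w).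
Proof. by rewrite qmapB subrr addr0 normcM. Qed.

Lemma orbitS c n z : orbit c n.+1 z = qmap c (orbit c n z).
Proof. by []. Qed.

Lemma orbitSr c n z : orbit c n.+1 z = orbit c n (qmap c z).
Proof. exact: iterSr. Qed.

Lemma orbit_continuous c n z e : 0 < e -> exists2 d, 0 < d &
  forall c' w, normc (c' - c) < d -> normc (w - z) < d ->
    normc (orbit c' n w - orbit c n z) < e.
Proof.
elim: n e => [|n IH] e e0; first by exists e.
set M := normc (orbit c n z).
have M0 : 0 <= M by exact: normc_ge0.
pose e' := Num.min 1 (e / (2 * (1 + 2 * M))).
have e'0 : 0 < e' by rewrite lt_min ltr01 divr_gt0 // mulr_gt0 //; lra.
have [d d0 dP] := IH _ e'0.
exists (Num.min d (e / 2)) => [|c' w]; first by rewrite lt_min d0 divr_gt0.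
rewrite !lt_min => /andP[c1 c2] /andP[w1 w2].
rewrite !orbitS qmapB (le_lt_trans (le_normcD _ _)) // normcM.
have := dP _ _ c1 w1; rewrite /e' lt_min => /andP[].
set a := orbit c' n w; set b := orbit c n z => h1.
rewrite ltr_pdivlMr; last by rewrite mulr_gt0 //; lra.
move=> h2.
have h3 : normc (a + b) <= 1 + 2 * M.
  have -> : a + b = (a - b) + (b + b) by ring.
  rewrite (le_trans (le_normcD _ _)) //.
  have : normc (b + b) <= M + M by exact: le_normcD.
  lra.
have := ler_wpM2l (normc_ge0 (a - b)) h3.
lra.
Qed.

(** Once [normc z] is at least [3] and at least [normc c], each step at least doubles
    the modulus. *)
Lemma escape c z : normc c <= normc z -> 3 <= normc z -> ~ filled c z.
Proof.
move=> cz z3 [M HM].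
have H n : normc z * 2 ^+ n <= normc (orbit c n z).
  elim: n => [|n IH]; first by rewrite expr0 mulr1.
  have zn : normc z <= normc (orbit c n z).
    rewrite (le_trans _ IH) // ler_peMr ?normc_ge0 //.
    by rewrite exprn_ege1 // ler1n.
  have : normc (orbit c n z) ^+ 2 <= normc (orbit c n.+1 z) + normc c.
    rewrite -normcX orbitS /qmap -[X in normc X <= _](addrK c).
    by rewrite (le_trans (le_normcD _ _)) // normcN.
  rewrite [2 ^+ n.+1]exprS mulrCA; nra.
have := H (Num.truncn M).+1; have := HM (Num.truncn M).+1.
have := truncnS_gt M.
have : (Num.truncn M).+1%:R <= 2 ^+ (Num.truncn M).+1 :> K.
  by rewrite -natrX ler_nat ltnW // ltn_expl.
have : 0 <= (Num.truncn M).+1%:R :> K by [].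
move: (_.+1%:R) (2 ^+ _) => a b *; nra.
Qed.

Lemma filled_le c z : filled c z -> normc z <= normc c + 3.
Proof.
move=> fz; rewrite leNgt; apply/negP => h; apply: (@escape c z) fz.
  by have := normc_ge0 c; lra.
by have := normc_ge0 c; lra.
Qed.

Lemma filled_qmap c z : filled c (qmap c z) <-> filled c z.
Proof.
split=> -[M HM].
  exists (Num.max M (normc z)) => -[|n]; first by rewrite le_max lexx orbT.
  by rewrite orbitSr le_max HM.
by exists M => n; rewrite -orbitSr.
Qed.

Lemma filled_orbit c n z : filled c (orbit c n z) <-> filled c z.
Proof. by elim: n => // n <-; rewrite orbitS filled_qmap. Qed.

(** Escape is decided after finitely many steps, hence is open jointly in the
    parameter and the point. *)
Lemma not_filled_stable c z : ~ filled c z -> exists2 d, 0 < d &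
  forall c' w, normc (c' - c) < d -> normc (w - z) < d -> ~ filled c' w.
Proof.
move=> nf; have [n Hn] : exists n, normc c + 5 < normc (orbit c n z).
  apply: contrapT => H; apply: nf; exists (normc c + 5) => n.
  by rewrite leNgt; apply/negP => h; apply: H; exists n.
have [d d0 dP] := orbit_continuous c n z ltr01.
exists (Num.min d 1) => [|c' w]; first by rewrite lt_min d0 ltr01.
rewrite !lt_min => /andP[c1 c2] /andP[w1 _] /(filled_orbit c' n w).
move: Hn (dP _ _ c1 w1); move: (orbit c' n w) (orbit c n z) => a b Hn ab.
have h1 := normc_triangle b a 0; rewrite !subr0 (normc_distC b) in h1.
have h2 := normc_triangle c' c 0; rewrite !subr0 in h2.
have h3 := normc_ge0 c.
by apply: escape; lra.
Qed.

Lemma juliaP c z : julia (quad c) z <-> jset c z.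
Proof.
split=> [[/= cl ni]|[fz nf]].
  have fz : filled c z.
    apply: contrapT => /not_filled_stable[d d0 dP].
    have [|w [/= /bounded_orbitP fw wd]] := cl [set w | normc (w - z) < d].
      by apply/nbhs_normcP; exists d.
    by apply: dP fw; rewrite ?subrr ?normc0.
  split=> // e e0; apply: contrapT => H; apply: ni.
  apply/nbhs_normcP; exists e => // w we; apply/bounded_orbitP.
  by apply: contrapT => nfw; apply: H; exists w.
split=> /=; first by apply: subset_closure; apply/bounded_orbitP.
move=> /nbhs_normcP[e e0 H]; have [w /H /bounded_orbitP] := nf _ e0; exact.
Qed.

Lemma jset_closed c z :
  (forall e, 0 < e -> exists2 w, jset c w & normc (w - z) < e) -> jset c z.
Proof.
move=> H; split=> [|e e0].
  apply: contrapT => /not_filled_stable[d d0 dP].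
  have [w [fw _] wz] := H _ d0; apply: (dP c w) => //.
  by rewrite subrr normc0.
have e20 : 0 < e / 2 by lra.
have [w [_ Jw] wz] := H _ e20; have [x xw nx] := Jw _ e20.
by exists x => //; have := normc_triangle x w z; lra.
Qed.

Lemma jset_le c z : jset c z -> normc z <= normc c + 3.
Proof. by case=> /filled_le. Qed.

(** Of the two preimages [x] and [-x] of [u], at least one is on the side of
    [z].  Comparing [normc (x - z)] with [normc (x + z)] selects a local
    inverse branch without any appeal to derivatives. *)
Lemma near_preimage c u z : exists2 x, qmap c x = u & normc (x - z) <= normc (x + z).
Proof.
have [x xu] := sqrt_exists (u - c).
have qx : qmap c x = u by rewrite /qmap xu subrK.
have [h|h] := leP (normc (x - z)) (normc (x + z)); first by exists x.
exists (- x); first by rewrite -qx /qmap sqrrN.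
by rewrite -opprD normcN [- x + z]addrC normc_distC ltW.
Qed.

Lemma near_preimage_sqr c x z : normc (x - z) <= normc (x + z) ->
  normc (x - z) ^+ 2 <= normc (qmap c x - qmap c z).
Proof. by move=> h; rewrite normc_qmapB expr2 ler_wpM2l ?normc_ge0. Qed.

(** The preimage selected by [near_preimage] depends continuously enough on its
    image: this is the openness of the quadratic map. *)
Lemma jset_back c y : jset c (qmap c y) -> jset c y.
Proof.
move=> [/filled_qmap fy H]; split=> // e e0.
have [u ue nu] := H _ (exprn_gt0 2 e0).
have [x xu xy] := near_preimage c u y.
exists x; last by move=> /filled_qmap; rewrite xu.
rewrite -(@ltr_pXn2r _ 2) ?nnegrE ?normc_ge0 ?(ltW e0) //.
by rewrite (le_lt_trans (near_preimage_sqr c xy)) // xu.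
Qed.

Lemma jset_fwd c y : jset c y -> jset c (qmap c y).
Proof.
move=> [fy H]; split=> [|e e0]; first exact/filled_qmap.
have [d d0 dP] := orbit_continuous c 1 y e0.
have [w wy nw] := H _ d0; exists (qmap c w); last by move=> /filled_qmap.
by apply: (dP c w); rewrite ?subrr ?normc0.
Qed.

(** The last parameter up to which the filled Julia set is reached gives the crossing
    point. *)
Lemma segment_crosses_jset c x (v : K[i]) : filled c x -> ~ filled c (x + v) ->
  exists2 t : K, 0 <= t <= 1 & jset c (x + t%:C * v).
Proof.
move=> fx nfy.
pose S := [set t : K | 0 <= t <= 1 /\ filled c (x + t%:C * v)].
have S0 : S 0 by split; [rewrite lexx ler01|rewrite mul0r addr0].
have ubS : ubound S 1 by move=> t [/andP[]].
have supS : has_sup S by split; [exists 0|exists 1].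
have s0 : 0 <= sup S by apply: ub_le_sup => //; exists 1.
have s1 : sup S <= 1 by apply: ge_sup => //; exists 0.
have close t t' : normc (x + t%:C * v - (x + t'%:C * v)) = `|t - t'| * normc v.
  by rewrite -normc_real rmorphB -normcM; congr normc; ring.
have v0 := normc_ge0 v.
have small e : 0 < e -> e / (1 + normc v) * normc v < e.
  by move=> e0; rewrite mulrAC ltr_pdivrMr ?mulrDr ?mulr1; lra.
have fs : filled c (x + (sup S)%:C * v).
  apply: contrapT => /not_filled_stable[d d0 dP].
  have dd : 0 < d / (1 + normc v) by rewrite divr_gt0 //; lra.
  have [t [t01 ft] st] := sup_adherent dd supS.
  apply: dP (ft); rewrite ?subrr ?normc0 // close.
  apply: le_lt_trans (small _ d0); rewrite ler_wpM2r //.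
  have : t <= sup S by apply: ub_le_sup; [exists 1|exact: (conj t01 ft)].
  rewrite ler_norml; lra.
exists (sup S); rewrite ?s0 //; split=> // e e0.
have ee : 0 < e / (1 + normc v) by rewrite divr_gt0 //; lra.
have slt : sup S < 1.
  rewrite lt_neqAle s1 andbT; apply/eqP => s1e; apply: nfy.
  by move: fs; rewrite s1e mul1r.
pose t := sup S + Num.min (e / (1 + normc v)) (1 - sup S).
have m0 : 0 < Num.min (e / (1 + normc v)) (1 - sup S).
  by rewrite lt_min ee; lra.
have m1 : Num.min (e / (1 + normc v)) (1 - sup S) <= e / (1 + normc v).
  by rewrite ge_min lexx.
have m2 : Num.min (e / (1 + normc v)) (1 - sup S) <= 1 - sup S.
  by rewrite ge_min lexx orbT.
exists (x + t%:C * v).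
  rewrite close; apply: le_lt_trans (small _ e0); rewrite ler_wpM2r //.
  by rewrite /t addrC addKr gtr0_norm.
move=> ft; have : t <= sup S.
  apply: ub_le_sup; first by exists 1.
  by split=> //; rewrite /t; lra.
by rewrite /t; lra.
Qed.

End Dynamics.

(** * From a Riemannian metric to uniform expansion near the Julia set *)

Section Expansion.
Variable K : realType.
Implicit Types (z w c x y u : K[i]) (d e r : K).

Lemma ex_below2 (a b : K) : 0 < a -> 0 < b -> exists2 e, 0 < e & e <= a /\ e <= b.
Proof.
move=> a0 b0; exists (Num.min a b); first by rewrite lt_min a0.
by rewrite !ge_min !lexx orbT.
Qed.

(** The average of the quadratic form [g z] over the unit circle, up to a factor [2]:
    the trace of [g z] in the Euclidean structure. *)
Definition mean_square (g : K[i] -> K[i] -> K[i] -> K) z : K := g z 1 1 + g z 'i 'i.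
Definition mean_norm g z : K := Num.sqrt (mean_square g z).

Section Metric.
Variables (V : set K[i]) (g : K[i] -> K[i] -> K[i] -> K).
Hypothesis gV : riemannian_metric V g.

Lemma mean_square_gt0 z : V z -> 0 < mean_square g z.
Proof.
case: gV => _ _ _ pos Vz; rewrite addr_gt0 // pos ?oner_neq0 //.
by rewrite eq_complex /= oner_eq0 andbF.
Qed.

Lemma mean_norm_gt0 z : V z -> 0 < mean_norm g z.
Proof. by move=> Vz; rewrite sqrtr_gt0 mean_square_gt0. Qed.

Lemma metric0 z u : V z -> g z 0 u = 0.
Proof.
case: gV => _ _ lin _ Vz.
have := lin z 1 0 0 u Vz; rewrite mulr0 addr0 mul1r; lra.
Qed.

Lemma metric_ge0 z v : V z -> 0 <= g z v v.
Proof.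
case: gV => _ _ _ pos Vz; have [->|v0] := eqVneq v 0; first by rewrite metric0.
by rewrite ltW // pos.
Qed.

(** The trace does not depend on the orthogonal basis: [v] and [v * 'i] are orthogonal
    of the same length. *)
Lemma mean_square_rotate z (v : K[i]) : V z ->
  g z v v + g z (v * 'i) (v * 'i) = normc v ^+ 2 * mean_square g z.
Proof.
case: gV => _ sym lin _ Vz; rewrite normc_sqr /mean_square.
have lin1 (t : K) w : g z (t%:C * w) =1 fun u => t * g z w u.
  by move=> u; rewrite -[_ * w]addr0 lin // metric0 // addr0.
have lin2 a b (w1 w2 u : K[i]) :
    g z (a%:C * w1 + b%:C * w2) u = a * g z w1 u + b * g z w2 u.
  by rewrite lin // lin1.
have -> : v = (complex.Re v)%:C * 1 + (complex.Im v)%:C * 'i.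
  by case: v => a b; apply/eqP; rewrite eq_complex /=; apply/andP; split; apply/eqP; ring.
set a := complex.Re v; set b := complex.Im v.
have -> : (a%:C * 1 + b%:C * 'i) * 'i = (- b)%:C * 1 + a%:C * 'i.
  by apply/eqP; rewrite eq_complex /=; apply/andP; split; apply/eqP; ring.
rewrite !lin2 ![g z _ (_ + _)]sym // !lin2 (sym z 'i 1) //=.
ring.
Qed.

Lemma mean_norm_continuous z : V z -> forall e, 0 < e ->
  exists2 d, 0 < d & forall w, normc (w - z) < d -> `|mean_norm g w - mean_norm g z| < e.
Proof.
case: gV => smooth _ _ _ Vz e e0.
have cont v : {for z, continuous (fun z => g z v v)}.
  by case: (smooth v v 0%N) => + _; exact.
have : {for z, continuous (mean_norm g)}.
  apply: continuous_comp; last exact: sqrt_continuous.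
  by apply: continuousD; exact: cont.
move=> /cvgrPdist_lt /(_ _ e0) /nbhs_normcP[d d0 H]; exists d => // w wd.
by rewrite distrC; exact: H.
Qed.

End Metric.

(** Uniform expansion near the Julia set of the conformal metric [rho(z) |dz|], in a
    form that needs neither derivatives nor a fixed parameter: [x + z] stands for the
    difference quotient of the map between [x] and [z], and [w] for the image of [z]
    under the quadratic map of any nearby parameter. *)
Definition expanding c (V : set K[i]) (rho : K[i] -> K) (r lam m M : K) : Prop :=
  [/\ 0 < r, 1 < lam, 0 < m, 0 < M & forall y z x w,
    jset c y -> normc (z - y) < r -> normc (x - z) < r ->
    normc (w - qmap c z) < r ->
    [/\ V z, V w, m <= rho z <= M, m <= rho w <= M
      & lam * rho z <= normc (x + z) * rho w]].

(** The derivative is multiplication by [z + z], which commutes with the rotation by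
    ['i].  Adding the expansion inequalities for [v = 1] and [v = 'i] therefore
    compares the traces at [z] and at its image. *)
Lemma hyperbolic_mean_norm c (N V : set K[i]) g : riemannian_metric V g ->
  uniformly_expanding (quad c) N V g ->
  exists2 k : K, 1 < k &
    forall z, N z -> k * mean_norm g z <= normc (z + z) * mean_norm g (qmap c z).
Proof.
move=> gV [NV fNV [k k1 H]]; exists k => // z Nz.
have Vz := NV _ Nz.
have Vfz : V (qmap c z) by apply: fNV; exists z; rewrite ?horner_quad.
have sq v : k ^+ 2 * g z v v <= g (qmap c z) ((z + z) * v) ((z + z) * v).
  have := H z v Nz; rewrite deriv_quad horner_quad /metric_norm => kv.
  have gv := metric_ge0 gV v Vz; have gfv := metric_ge0 gV ((z + z) * v) Vfz.
  move: kv; rewrite -ler_sqr ?nnegrE ?mulr_ge0 ?sqrtr_ge0 //; last lra.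
  by rewrite exprMn !sqr_sqrtr.
have k0 : 0 <= k by lra.
have s0 : 0 <= mean_square g z by rewrite ltW // (mean_square_gt0 gV).
rewrite -ler_sqr ?nnegrE ?mulr_ge0 ?sqrtr_ge0 ?normc_ge0 //.
rewrite !exprMn !sqr_sqrtr // ?(ltW (mean_square_gt0 gV _)) //.
rewrite -(mean_square_rotate gV) // /mean_square mulrDr.
by apply: lerD; [have := sq 1; rewrite mulr1|exact: sq].
Qed.

Lemma inverse_bounds (A a eta e : K) : 0 < e -> e <= A / 2 -> e <= (A + A)^-1 ->
  eta <= A / 2 -> `|a - A| < eta -> e / 2 <= a <= (e / 2)^-1.
Proof.
move=> e0 eA eA' etaA; rewrite ltr_norml => /andP[a1 a2].
have iA : A + A <= (e / 2)^-1.
  by rewrite -[A + A]invrK lef_pV2 ?posrE ?invr_gt0 ?addr_gt0 //; lra.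
by apply/andP; split; lra.
Qed.

(** The arithmetic of the continuity argument: at [A], [B] and [D] the inequality holds
    with [k] in place of [lam].  The passage to [a] and [b], and the loss of at most [del]
    in the passage to [x], may each use up half of the room [(k - lam) * A]. *)
Lemma expansion_with_room (k lam A B D eta del a b x : K) :
  0 < lam -> 0 <= D -> 0 < del -> eta <= B / 2 -> k * A <= D * B ->
  eta * (lam + D) <= (k - lam) * A / 2 -> del * B <= (k - lam) * A / 4 ->
  `|a - A| < eta -> `|b - B| < eta -> D <= x + del -> lam * a <= x * b.
Proof.
move=> lam0 D0 del0 etaB kAB etas dels; rewrite !ltr_norml => /andP[aA aA'] /andP[bB bB'] Dx.
have b0 : 0 <= b by lra.
have lz : lam * a <= lam * (A + eta) by rewrite ler_pM2l //; lra.
have p1 : D * b <= (x + del) * b by rewrite ler_wpM2r.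
have p2 : D * (B - eta) <= D * b by rewrite ler_wpM2l //; lra.
have p3 : del * b <= del * (B + B) by rewrite ler_pM2l //; lra.
lra.
Qed.

(** At a point [y] of the Julia set the inequality holds with the larger factor [k], and
    all its ingredients are continuous, so it persists with a smaller factor [lam] at
    nearby [z], [x] and [w]; compactness makes the size of nearby uniform.  A single
    scale [e] serves as radius, as lower bound and as inverse upper bound of [rho]. *)
Lemma hyperbolic_expanding c : hyperbolic (quad c) ->
  exists V g, [/\ open V, riemannian_metric V g &
    exists r lam m M, expanding c V (mean_norm g) r lam m M].
Proof.
case=> N [V [g [oN JN oV gV exN]]]; exists V, g; split=> //.
have [NV fNV _] := exN.
have [k k1 kP] := hyperbolic_mean_norm gV exN.
pose lam := (1 + k) / 2.
have lam1 : 1 < lam by rewrite /lam; lra.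
have lamk : lam < k by rewrite /lam; lra.
pose rho := mean_norm g.
pose P y e := forall z x w, normc (z - y) < e -> normc (x - z) < e ->
  normc (w - qmap c z) < e ->
  [/\ V z, V w, e <= rho z <= e^-1, e <= rho w <= e^-1
    & lam * rho z <= normc (x + z) * rho w].
suff [e e0 H] : exists2 e, 0 < e & forall y, jset c y -> P y e.
  by exists e, lam, e, e^-1; split; rewrite ?invr_gt0 // => y z x w Jy; exact: H.
apply: (@compact_uniform _ _ P (normc c + 3)).
- by move=> z; exact: jset_le.
- by move=> z; exact: jset_closed.
- move=> y d e d0 de H z x w h1 h2 h3.
  have [] := H z x w (lt_le_trans h1 de) (lt_le_trans h2 de) (lt_le_trans h3 de).
  move=> ? ? /andP[? ?] /andP[? ?] ?.
  have : e^-1 <= d^-1 by rewrite lef_pV2 ?posrE //; lra.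
  by split=> //; apply/andP; split; lra.
move=> y Jy.
have Ny : N y by apply: JN; apply/juliaP.
have Vy := NV _ Ny.
have Vfy : V (qmap c y) by apply: fNV; exists y; rewrite ?horner_quad.
have A0 : 0 < rho y by exact: (mean_norm_gt0 gV).
have B0 : 0 < rho (qmap c y) by exact: (mean_norm_gt0 gV).
have D0 := normc_ge0 (y + y).
have kAB := kP _ Ny.
rewrite -/rho in kAB.
set A := rho y in A0 kAB *; set B := rho (qmap c y) in B0 kAB *.
set D := normc (y + y) in D0 kAB *.
have slack : 0 < (k - lam) * A by rewrite mulr_gt0 //; lra.
have lamD : 0 < lam + D by lra.
have [eta eta0 [etaA etaB etas]] : exists2 eta, 0 < eta &
    [/\ eta <= A / 2, eta <= B / 2 & eta * (lam + D) <= (k - lam) * A / 2].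
  have pos : 0 < (k - lam) * A / 2 / (lam + D) by rewrite !divr_gt0.
  have [//||eta0 eta00 [eA eB]] := @ex_below2 (A / 2) (B / 2); try lra.
  have [eta eta0' [e0' es]] := ex_below2 eta00 pos.
  exists eta => //; split; rewrite -?ler_pdivlMr //; lra.
have [del del0 dels] : exists2 del, 0 < del & del * B <= (k - lam) * A / 4.
  exists ((k - lam) * A / 4 / B); first by rewrite !divr_gt0.
  by rewrite divfK ?gt_eqF.
have [d1 d10 h1] := mean_norm_continuous gV Vy eta0.
have [d2 d20 h2] := mean_norm_continuous gV Vfy eta0.
have /open_normcP /(_ _ Vy) [d3 d30 h3] := oV.
have /open_normcP /(_ _ Vfy) [d4 d40 h4] := oV.
have [d5 d50 [d52 d54]] := ex_below2 d20 d40.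
have d52' : 0 < d5 / 2 by lra.
have [d6 d60 h6] := orbit_continuous c 1 y d52'.
pose eps := \big[Num.min/d1]_(x <- [:: d3; d6; d5; del / 3; A / 2; B / 2;
  (A + A)^-1; (B + B)^-1]) x.
have eps0 : 0 < eps.
  by rewrite /eps !big_cons big_nil !lt_min d10 d30 d60 d50 !invr_gt0 !addr_gt0 ?divr_gt0.
have := lexx eps; rewrite {2}/eps !big_cons big_nil !le_min.
move=> /and5P[ed3 ed6 ed5 edel /and5P[eA eB eA' eB' ed1]].
clearbody eps.
have e20 : 0 < eps / 2 by lra.
exists (eps / 2) => // y' Jy' yy' z x w zy xz wz.
have zy' : normc (z - y) < eps by have := normc_triangle z y' y; lra.
have wfy : normc (w - qmap c y) < d5.
  have : normc (qmap c z - qmap c y) < d5 / 2.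
    by apply: (h6 c z); rewrite ?subrr ?normc0 //; lra.
  have := normc_triangle w (qmap c z) (qmap c y); lra.
have rz := h1 z (lt_le_trans zy' ed1); have rw := h2 w (lt_le_trans wfy d52).
split.
- exact: h3 (lt_le_trans zy' ed3).
- exact: h4 (lt_le_trans wfy d54).
- exact: inverse_bounds eps0 eA eA' etaA rz.
- exact: inverse_bounds eps0 eB eB' etaB rw.
apply: (expansion_with_room _ D0 del0 etaB kAB etas dels rz rw).
  by rewrite (lt_trans ltr01).
have -> : D = normc ((x + z) - (x - z + ((z - y) + (z - y)))).
  by rewrite /D; congr normc; ring.
have := le_normcD (x + z) (- (x - z + ((z - y) + (z - y)))).
have := le_normcD (x - z) ((z - y) + (z - y)).
have := le_normcD (z - y) (z - y).
rewrite normcN; lra.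
Qed.

End Expansion.

(** * Hyperbolicity from an expanded conformal metric *)

Section Smoothness.
Variable K : realType.
Implicit Types (z w c x y u : K[i]) (d e r : K).

Lemma near_line (V : set K[i]) z v : open V -> V z ->
  \forall t \near (0 : K), V (z + t%:C * v).
Proof.
move=> /open_normcP oV /oV[e e0 H].
have v0 := normc_ge0 v.
apply/nbhs_ballP; exists (e / (1 + normc v)) => [|t]; first by rewrite /= divr_gt0 //; lra.
rewrite -ball_normE /= sub0r normrN ltr_pdivlMr; last lra.
move=> te; apply: H; rewrite addrC addKr normcM normc_real.
have := normr_ge0 t; lra.
Qed.

Lemma continuous_ext (V : set K[i]) (h h' : K[i] -> K) z : open V -> V z ->
  (forall z, V z -> h z = h' z) -> {for z, continuous h} -> {for z, continuous h'}.
Proof.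
move=> oV Vz hh'; rewrite /prop_for /continuous_at -hh' // => hc.
move=> A /hc /nbhs_normcP[d d0 Hd]; have /open_normcP /(_ _ Vz)[e e0 He] := oV.
apply/nbhs_normcP; exists (Num.min d e) => [|w]; first by rewrite lt_min d0.
rewrite lt_min => /andP[wd we]; rewrite /= -hh'; [exact: Hd|exact: He].
Qed.

(** Only the values on [V] matter: [V] is open, so the derivatives at its points do not
    see the rest. *)
Lemma class_C_ext n (V : set K[i]) (h h' : K[i] -> K) : open V ->
  (forall z, V z -> h z = h' z) -> class_C n V h -> class_C n V h'.
Proof.
move=> oV; elim: n h h' => [|n IH] h h' hh' [hc hd].
  split=> // z Vz; exact: continuous_ext hh' (hc _ Vz).
have line z v : V z -> \forall t \near (0 : K), h (z + t%:C * v) = h' (z + t%:C * v).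
  by move=> Vz; apply: filterS (near_line v oV Vz) => t /hh'.
split=> [z Vz|v]; first exact: continuous_ext hh' (hc _ Vz).
have [hd1 hd2] := hd v; split=> [z Vz|].
  apply: near_eq_derivable (hd1 _ Vz).
  exact: line.
apply: IH hd2 => z Vz; rewrite /dir_deriv !derive1E.
apply: near_eq_derive.
exact: line.
Qed.

Lemma class_C_lin n (V : set K[i]) (a b : K) (h1 h2 : K[i] -> K) : open V ->
  class_C n V h1 -> class_C n V h2 -> class_C n V (fun z => a * h1 z + b * h2 z).
Proof.
move=> oV; elim: n h1 h2 => [|n IH] h1 h2 [c1 d1] [c2 d2].
  split=> // z Vz; apply: continuousD; apply: continuousM; try exact: cst_continuous.
    exact: c1.
  exact: c2.
split=> [z Vz|v].
  apply: continuousD; apply: continuousM; try exact: cst_continuous.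
    exact: c1.
  exact: c2.
have [d11 d12] := d1 v; have [d21 d22] := d2 v.
split=> [z Vz|].
  by apply: derivableD; apply: derivableZ; [exact: d11|exact: d21].
apply: class_C_ext (IH _ _ d12 d22) => // z Vz.
rewrite /dir_deriv !derive1E.
have D1 := derivableZ (k:=a) (d11 _ Vz); have D2 := derivableZ (k:=b) (d21 _ Vz).
have := deriveD D1 D2.
rewrite deriveZ; last exact: d11.
rewrite deriveZ; last exact: d21.
by move=> <-.
Qed.

(** The average of [g z] over all rotations of the tangent plane, up to a factor [2].  It
    is smooth because it combines values of [g] linearly, and conformal, so that its
    expansion is that of the scalar weight [mean_norm g]. *)
Definition conformal_metric (g : K[i] -> K[i] -> K[i] -> K) z v w : K :=
  (complex.Re v * complex.Re w + complex.Im v * complex.Im w) * mean_square g z.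

Lemma conformal_metricP (V : set K[i]) g : open V ->
  riemannian_metric V g -> riemannian_metric V (conformal_metric g).
Proof.
move=> oV gV; have [smooth _ _ _] := gV.
split.
- move=> v w n; rewrite /conformal_metric.
  pose a := complex.Re v * complex.Re w + complex.Im v * complex.Im w.
  have := class_C_lin a a oV (smooth 1 1 n) (smooth 'i 'i n).
  by apply: class_C_ext oV _ => z _; rewrite -/a /mean_square mulrDr.
- by move=> z v w _; rewrite /conformal_metric; congr (_ * _); ring.
- move=> z t u v w _; rewrite /conformal_metric.
  by case: u v w => [? ?] [? ?] [? ?] /=; ring.
- move=> z v Vz v0; rewrite /conformal_metric mulr_gt0 ?(mean_square_gt0 gV) //.
  by rewrite -!expr2 -normc_sqr exprn_gt0 // normc_gt0.
Qed.

Lemma conformal_metric_norm g z v :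
  metric_norm (conformal_metric g) z v = normc v * mean_norm g z.
Proof.
rewrite /metric_norm /conformal_metric -!expr2 -normc_sqr sqrtrM ?sqr_ge0 //.
by rewrite sqrtr_sqr ger0_norm ?normc_ge0.
Qed.

Lemma hyperbolic_of_expansion c (N V : set K[i]) g (lam : K) :
  open N -> (forall z, jset c z -> N z) -> open V -> riemannian_metric V g ->
  1 < lam ->
  (forall z, N z -> [/\ V z, V (qmap c z) &
    lam * mean_norm g z <= normc (z + z) * mean_norm g (qmap c z)]) ->
  hyperbolic (quad c).
Proof.
move=> oN JN oV gV lam1 H; exists N, V, (conformal_metric g).
split=> //; [by move=> z /juliaP/JN|exact: conformal_metricP|].
split=> [z /H[]//|_ [z /H[_ Vfz _] <-]|]; first by rewrite horner_quad.
exists lam => // z v Nz; have [_ _ le] := H z Nz.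
rewrite !conformal_metric_norm deriv_quad horner_quad normcM.
have := ler_wpM2l (normc_ge0 v) le; lra.
Qed.

End Smoothness.

(** * One step of a perturbed map near the Julia set *)

Section Stability.
Variable K : realType.
Implicit Types (z w x y u s t : K[i]) (d e r q : K).

(** Bernoulli's inequality. *)
Lemma ex_exp_gt (lam C D : K) : 1 < lam -> 0 < D -> exists n, C < lam ^+ n * D.
Proof.
move=> lam1 D0; pose n := (Num.truncn (C / D / (lam - 1))).+1; exists n.
have l0 : 0 < lam - 1 by lra.
have : C / D / (lam - 1) < n%:R by exact: truncnS_gt.
rewrite !ltr_pdivrMr // => h; apply: (lt_le_trans h); rewrite ler_pM2r //.
elim: (n) => [|k IH]; first by rewrite mul0r expr0.
rewrite exprS -natr1.
have k1 : 1 <= lam ^+ k by rewrite exprn_ege1 // ltW.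
nra.
Qed.

Section Expanding.
Variables (c : K[i]) (V : set K[i]) (rho : K[i] -> K) (r0 lam m M : K).
Hypothesis expP : expanding c V rho r0 lam m M.

Let r00 : 0 < r0. Proof. by case: expP. Qed.
Let lam1 : 1 < lam. Proof. by case: expP. Qed.
Let m0 : 0 < m. Proof. by case: expP. Qed.
Let M0 : 0 < M. Proof. by case: expP. Qed.

Definition near_jset r z := exists2 y, jset c y & normc (z - y) < r.

Lemma near_jset_le r r' z : r <= r' -> near_jset r z -> near_jset r' z.
Proof. by move=> rr [y Jy zy]; exists y => //; exact: lt_le_trans rr. Qed.

Lemma near_jset_trans r r' z w : near_jset r z -> normc (w - z) <= r' ->
  near_jset (r + r') w.
Proof.
case=> y Jy zy wz; exists y => //; have := normc_triangle w z y; lra.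
Qed.

Lemma jset_near r z : 0 < r -> jset c z -> near_jset r z.
Proof. by move=> r_gt0 Jz; exists z; rewrite ?subrr ?normc0. Qed.

Lemma qmap_param s z : normc (qmap s z - qmap c z) = normc (s - c).
Proof. by rewrite qmapB subrr mul0r add0r. Qed.

Lemma weight_bounds z : near_jset r0 z -> m <= rho z <= M.
Proof.
case: expP => _ _ _ _ E [y Jy zy].
by have [] := E y z z (qmap c z); rewrite ?subrr ?normc0.
Qed.

Lemma weight_bounds_qmap s z : near_jset r0 z -> normc (s - c) < r0 ->
  m <= rho (qmap s z) <= M.
Proof.
case: expP => _ _ _ _ E [y Jy zy] sc.
by have [] := E y z z (qmap s z); rewrite ?qmap_param ?subrr ?normc0.
Qed.

(** The exact expansion factor of the distance from [z] to [x] is [normc (x + z)]. *)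
Lemma expand s z x : near_jset r0 z -> normc (x - z) < r0 -> normc (s - c) < r0 ->
  lam * (rho z * normc (x - z)) <=
  rho (qmap s z) * normc (qmap s x - qmap s z).
Proof.
case: expP => _ _ _ _ E [y Jy zy] xz sc.
have [||||_ _ _ _ H] // := E y z x (qmap s z); first by rewrite qmap_param.
rewrite normc_qmapB; have := ler_wpM2l (normc_ge0 (x - z)) H; lra.
Qed.

(** The inverse step from [qmap s z] to the preimage [x] on the side of [z], taken with a
    different parameter [t], costs at most [M * normc (t - s)].  The smallness
    assumption bounds [normc (x - z) ^+ 2], hence brings [x] within reach of
    [expand]. *)
Lemma contract s t z x : near_jset r0 z -> normc (s - c) < r0 ->
  normc (x - z) <= normc (x + z) ->
  normc (qmap t x - qmap s z) + normc (t - s) < r0 ^+ 2 ->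
  lam * (rho z * normc (x - z)) <=
  rho (qmap s z) * normc (qmap t x - qmap s z) + M * normc (t - s).
Proof.
move=> Jz sc xz small.
have le : normc (qmap s x - qmap s z) <=
    normc (qmap t x - qmap s z) + normc (t - s).
  have := normc_triangle (qmap s x) (qmap t x) (qmap s z).
  have -> : qmap s x - qmap t x = s - t by rewrite /qmap; ring.
  rewrite (normc_distC s); lra.
have xr : normc (x - z) < r0.
  rewrite -(@ltr_pXn2r _ 2) ?nnegrE ?normc_ge0 ?(ltW r00) //.
  by have := near_preimage_sqr s xz; lra.
have /andP[b1 b2] := weight_bounds_qmap Jz sc.
have h1 := expand Jz xr sc.
have rw0 : 0 <= rho (qmap s z) by have := m0; lra.
have h2 := ler_wpM2l rw0 le.
have h3 := ler_wpM2r (normc_ge0 (t - s)) b2.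
lra.
Qed.

(** Distances to the Julia set are weighted by [rho], because it is for the weighted
    distance that the preimage of the tube is smaller than the tube. *)
Definition tube q z := exists2 y, jset c y & rho y * normc (z - y) < q.

Lemma weight_jset y : jset c y -> m <= rho y <= M.
Proof. by move=> Jy; apply: weight_bounds; exact: jset_near. Qed.

Lemma jset_tube q y : 0 < q -> jset c y -> tube q y.
Proof. by move=> q0 Jy; exists y; rewrite ?subrr ?normc0 ?mulr0. Qed.

Lemma tube_near q r z : q <= m * r -> tube q z -> near_jset r z.
Proof.
move=> qr [y Jy yz]; exists y => //.
have /andP[b1 b2] := weight_jset Jy.
have := ler_wpM2r (normc_ge0 (z - y)) b1.
rewrite -(ltr_pM2l m0); lra.
Qed.

(** If [y] in the Julia set were close to the critical point [0], then [- y] would be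
    close to [y] and have the same image, against the expansion. *)
Lemma tube_far0 q : q <= m * (r0 / 2) -> ~ tube q 0.
Proof.
move=> qr [y Jy]; rewrite sub0r normcN => yq.
have /andP[b1 b2] := weight_jset Jy.
have yr : r0 <= normc (y + y).
  rewrite leNgt; apply/negP => h.
  case: expP => _ _ _ _ /(_ y y (- y) (qmap c y) Jy).
  rewrite !subrr normc0 -opprD normcN addNr normc0 mul0r => /(_ r00 h r00)[_ _ _ _].
  by rewrite leNgt mulr_gt0 //; have := m0; have := lam1; lra.
have := le_normcD y y; have := ler_wpM2r (normc_ge0 y) b1.
have h : r0 / 2 <= normc y by have := le_normcD y y; lra.
have := ler_wpM2l (ltW m0) h; lra.
Qed.

(** Near [qmap t z] lies a point of the Julia set; its preimage on the side of [z] is in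
    the Julia set, and the inverse step contracts by more than the change of parameter
    costs. *)
Lemma tube_back q t z : 0 < q -> q <= m * (r0 ^+ 2 / 2) ->
  normc (t - c) < r0 ^+ 2 / 2 -> M * normc (t - c) < (lam - 1) * q ->
  tube q (qmap t z) -> tube q z.
Proof.
move=> q0 qr tr tq [y' Jy' zy'].
have [y yy' yz] := near_preimage c y' z.
have Jy : jset c y by apply: jset_back; rewrite yy'.
exists y => //.
have /andP[b1 b2] := weight_jset Jy'.
have : normc (qmap t z - y') < r0 ^+ 2 / 2.
  rewrite -(ltr_pM2l m0); have := ler_wpM2r (normc_ge0 (qmap t z - y')) b1; lra.
rewrite -yy' => h1.
have := @contract c t y z (jset_near r00 Jy).
rewrite subrr normc0 yy' => /(_ r00); rewrite normc_distC [z + y]addrC => /(_ yz).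
rewrite yy' in h1; move=> /(_ _) h2.
have {}h2 : lam * (rho y * normc (y - z)) <=
    rho y' * normc (qmap t z - y') + M * normc (t - c) by apply: h2; lra.
rewrite -(@ltr_pM2l _ lam); have := lam1; lra.
Qed.

(** Both [filled c] and the complement of the tube survive one step under the parameter
    [t].  For [filled c]: as the parameter moves from [c] to [t], the image of a point
    moves along a segment; if it left [filled c], it would cross the Julia set, and the
    point would have been in the tube by [tube_back]. *)
Lemma outside_tube_filled q t z : 0 < q -> q <= m * (r0 ^+ 2 / 2) ->
  normc (t - c) < r0 ^+ 2 / 2 -> M * normc (t - c) < (lam - 1) * q ->
  filled c z -> ~ tube q z -> filled t z.
Proof.
move=> q0 qr tr tq fz Tz.
suff H n : filled c (orbit t n z) /\ ~ tube q (orbit t n z).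
  by exists (normc c + 3) => n; apply: filled_le; have [] := H n.
elim: n => // n; rewrite orbitS; move: (orbit t n z) => w [fw Tw].
split; last by move=> /(tube_back q0 qr tr tq).
apply: contrapT => nf.
have e1 : qmap t w = qmap c w + (t - c) by rewrite /qmap; ring.
rewrite e1 in nf; have [|th /andP[th0 th1]] := segment_crosses_jset _ nf.
  exact/filled_qmap.
have -> : qmap c w + th%:C * (t - c) = qmap (c + th%:C * (t - c)) w by rewrite /qmap; ring.
move=> J; apply: Tw.
have le : normc (c + th%:C * (t - c) - c) <= normc (t - c).
  rewrite addrC addKr normcM normc_real ger0_norm //.
  by rewrite ler_piMl ?normc_ge0.
apply: (tube_back q0 qr _ _ (jset_tube q0 J)); first exact: le_lt_trans tr.
by apply: le_lt_trans tq; rewrite ler_wpM2l // ltW.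
Qed.

End Expanding.
End Stability.

(** * Persistence of the Julia set *)

Section Persistence.
Variable K : realType.
Implicit Types (z w x y u s t : K[i]) (d e r q : K).
Variables (c : K[i]) (V : set K[i]) (rho : K[i] -> K) (r0 lam m M : K).
Hypothesis expP : expanding c V rho r0 lam m M.

Let r00 : 0 < r0. Proof. by case: expP. Qed.
Let lam1 : 1 < lam. Proof. by case: expP. Qed.
Let m0 : 0 < m. Proof. by case: expP. Qed.
Let M0 : 0 < M. Proof. by case: expP. Qed.

Lemma not_jset_interior z : filled c z -> ~ jset c z ->
  exists2 e, 0 < e & forall w, normc (w - z) < e -> filled c w.
Proof.
move=> fz nJ; apply: contrapT => H; apply: nJ; split=> // e e0.
apply: contrapT => H'; apply: H; exists e => // w we.
by apply: contrapT => nf; apply: H'; exists w.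
Qed.

(** A bounded region splits into the tube, the points of [filled c] outside it, and
    escaping points.  For [t] near [c] the second kind has bounded orbits, and so have
    all points near it, so it does not meet the Julia set of [t]; the third kind still
    escapes, uniformly by compactness. *)
Lemma persistence r : filled c 0 -> 0 < r -> exists2 d, 0 < d &
  forall t, normc (t - c) < d -> filled t 0 /\ forall z, jset t z -> near_jset c r z.
Proof.
move=> f0 r_gt0.
have r02 : 0 < r0 ^+ 2 / 2 by rewrite divr_gt0 ?exprn_gt0.
pose q := m * Num.min r (Num.min (r0 ^+ 2 / 2) (r0 / 2)).
have q0 : 0 < q by rewrite mulr_gt0 // !lt_min r_gt0 r02 divr_gt0.
have [qr qr2 qr1] : [/\ q <= m * r, q <= m * (r0 ^+ 2 / 2) & q <= m * (r0 / 2)].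
  by rewrite !ler_pM2l // !ge_min !lexx !orbT.
(* Two radii, [q] and [q / 2], are needed: near a point outside the tube of radius [q]
   all points are outside the tube of radius [q / 2]. *)
have fillt q' t z : q / 2 <= q' -> q' <= q -> normc (t - c) < r0 ^+ 2 / 2 ->
    M * normc (t - c) < (lam - 1) * (q / 2) ->
    filled c z -> ~ tube c rho q' z -> filled t z.
  move=> q1 q2 t1 t2; have := lam1 => l1.
  apply: (outside_tube_filled expP) => //; try lra.
  have := ler_wpM2l (_ : 0 <= lam - 1) q1; lra.
pose P z e := [\/ tube c rho q z, filled c z | forall t, normc (t - c) < e -> ~ filled t z].
have [d2 d20 esc] : exists2 e, 0 < e & forall z, normc z <= normc c + 4 -> P z e.
  apply: (@compact_uniform _ [set z | normc z <= normc c + 4] P (normc c + 4)) => //.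
  - move=> z H /=; rewrite leNgt; apply/negP => h.
    have [|w /= wc wz] := H (normc z - (normc c + 4)); first lra.
    have := normc_triangle z w 0; rewrite !subr0 (normc_distC z); lra.
  - move=> z d e d0 de [T|f|H]; [exact: Or31|exact: Or32|apply: Or33 => t td].
    by apply: H; lra.
  move=> z _; have [fz|nf] := pselect (filled c z).
    have [Jz|nJ] := pselect (jset c z).
      exists (q / M) => [|w _ wz]; first by rewrite divr_gt0.
      apply: Or31; exists z => //; have /andP[_ b2] := weight_jset expP Jz.
      move: wz; rewrite ltr_pdivlMr // mulrC; apply: le_lt_trans.
      by rewrite ler_wpM2r ?normc_ge0 //; lra.
    have [e e0 He] := not_jset_interior fz nJ; exists e => // w _ /He; exact: Or32.
  have [d d0 H] := not_filled_stable nf.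
  by exists d => // w _ wz; apply: Or33 => t td; exact: H.
pose d1 := (lam - 1) * (q / 2) / M.
have d10 : 0 < d1 by rewrite divr_gt0 // mulr_gt0; have := lam1; lra.
exists (Num.min (Num.min d1 d2) (Num.min (r0 ^+ 2 / 2) 1)) => [|t].
  by rewrite !lt_min d10 d20 r02 ltr01.
rewrite !lt_min => /andP[/andP[td1 td2] /andP[tr t1]].
have tM : M * normc (t - c) < (lam - 1) * (q / 2).
  by move: td1; rewrite /d1 ltr_pdivlMr // mulrC.
split; first by apply: (fillt q) => //; [lra|exact: (tube_far0 expP)].
move=> z Jz; apply: (tube_near expP qr); apply: contrapT => nT.
have [ft nt] := Jz.
have zc : normc z <= normc c + 4.
  have := jset_le Jz; have := normc_triangle t c 0; rewrite !subr0; lra.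
have [//|fz|/(_ t td2)//] := esc z zc.
have nJ : ~ jset c z by move=> /(jset_tube rho q0).
have [e e0 He] := not_jset_interior fz nJ.
pose e' := Num.min e (q / 2 / M).
have e'0 : 0 < e' by rewrite lt_min e0 !divr_gt0.
have [w wz nw] := nt _ e'0; apply: nw.
move: wz; rewrite lt_min ltr_pdivlMr // => /andP[we wq].
apply: (fillt (q / 2)) => //; [lra|exact: He|].
move=> [y Jy yw]; apply: nT; exists y => //.
have /andP[b1 b2] := weight_jset expP Jy.
have r1 : 0 <= rho y by have := m0; lra.
have := ler_wpM2l r1 (normc_triangle z w y).
have : rho y * normc (z - w) <= M * normc (z - w).
  by rewrite ler_wpM2r ?normc_ge0 //; lra.
rewrite (normc_distC z w); lra.
Qed.

(** * Shadowing *)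

(** The scales at which inverse steps are under control: [q] bounds weighted distances,
    hence [q / m] bounds distances. *)
Definition shadow_scale q := [/\ 0 < q, q / m < r0 & q / m < r0 ^+ 2 / 2].

(** The loss [M * normc (t - s)] of an inverse step is compensated by its contraction at
    the scale [q]. *)
Definition param_close q s t :=
  [/\ normc (s - c) < r0, normc (t - s) < r0 ^+ 2 / 2
    & M * normc (t - s) <= (lam - 1) * q].

Lemma weight_normc q z v : near_jset c r0 z -> rho z * v <= q -> 0 <= v -> v <= q / m.
Proof.
move=> Jz h v0; rewrite ler_pdivlMr //; apply: le_trans h.
by rewrite mulrC ler_wpM2r //; have /andP[] := weight_bounds expP Jz.
Qed.

Lemma pull q s t z u : shadow_scale q -> param_close q s t -> near_jset c r0 z ->
  rho (qmap s z) * normc (u - qmap s z) <= q ->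
  exists2 x, qmap t x = u & rho z * normc (x - z) <= q.
Proof.
move=> [q0 qr qr2] [sc tsr tsM] Jz uq.
have [x xu xz] := near_preimage t u z; exists x => //.
have /andP[b1 b2] := weight_bounds_qmap expP Jz sc.
have uz : normc (u - qmap s z) <= q / m.
  rewrite ler_pdivlMr //; apply: le_trans uq.
  by rewrite mulrC ler_wpM2r ?normc_ge0.
have h : lam * (rho z * normc (x - z)) <=
    rho (qmap s z) * normc (qmap t x - qmap s z) + M * normc (t - s).
  apply: (contract expP) => //; rewrite xu; lra.
rewrite xu in h; have l0 : 0 < lam by have := lam1; lra.
rewrite -(ler_pM2l l0); lra.
Qed.

(** Iterated inverse steps: any endpoint [u] close to the end of an orbit of [s] is reached
    by an orbit of [t] that stays close to it all the way. *)
Lemma pull_orbit q s t n z u : shadow_scale q -> param_close q s t ->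
  (forall j, (j < n)%N -> near_jset c r0 (orbit s j z)) ->
  rho (orbit s n z) * normc (u - orbit s n z) <= q ->
  exists2 x, orbit t n x = u &
    forall j, (j <= n)%N -> rho (orbit s j z) * normc (orbit t j x - orbit s j z) <= q.
Proof.
move=> qs pc; elim: n z => [|n IH] z Hz uq.
  by exists u => // j; rewrite leqn0 => /eqP ->.
have [j jn||x' xu H] := IH (qmap s z); rewrite -?orbitSr //; first exact: Hz.
have [|x xx' xz] := pull qs pc (Hz 0%N isT) (u := x'); first exact: (H 0%N).
exists x; first by rewrite orbitSr xx'.
by case=> [//|j] jn; rewrite !orbitSr xx'; apply: H.
Qed.

Lemma expand_orbit s n z x : normc (s - c) < r0 ->
  (forall j, (j < n)%N -> near_jset c r0 (orbit s j z) /\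
    normc (orbit s j x - orbit s j z) < r0) ->
  lam ^+ n * (rho z * normc (x - z)) <=
  rho (orbit s n z) * normc (orbit s n x - orbit s n z).
Proof.
move=> sc; elim: n => [|n IH] H; first by rewrite expr0 mul1r.
have [Jn xn] := H n (ltnSn n).
rewrite !orbitS; apply: le_trans (expand expP Jn xn sc).
rewrite exprS -mulrA ler_wpM2l //; first by have := lam1; lra.
by apply: IH => j jn; apply: H; exact: ltnW.
Qed.

Lemma expand_orbit_bound s n z x : normc (s - c) < r0 ->
  (forall j, (j <= n)%N -> near_jset c r0 (orbit s j z) /\
    normc (orbit s j x - orbit s j z) < r0) ->
  lam ^+ n * (m * normc (x - z)) <= M * r0.
Proof.
move=> sc H; have h := expand_orbit sc (fun j jn => H j (ltnW jn)).
have [Jn xn] := H n (leqnn n); have [Jz _] := H 0%N isT.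
have /andP[b1 b2] := weight_bounds expP Jn.
have /andP[b3 b4] := weight_bounds expP Jz.
have l0 : 0 <= lam ^+ n by rewrite exprn_ge0 //; have := lam1; lra.
have h1 := ler_wpM2l l0 (ler_wpM2r (normc_ge0 (x - z)) b3).
have rn : 0 <= rho (orbit s n z) by have := m0; lra.
have h2 := ler_wpM2l rn (ltW xn).
have h3 := ler_wpM2r (ltW r00) b2.
rewrite /orbit /= in h1 h2 h3 h *; lra.
Qed.

(** The points whose [t]-orbit follows the given orbit for [n] steps exist by [pull_orbit]
    and form a decreasing sequence of compact sets; a cluster point follows forever. *)
Lemma shadowing q s t z : shadow_scale q -> param_close q s t ->
  (forall j, near_jset c r0 (orbit s j z)) ->
  exists x, forall n, normc (orbit t n x - orbit s n z) <= q / m.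
Proof.
move=> qs pc Hz; have [q0 _ _] := qs.
have /choice[u uP] n : exists x, forall j, (j <= n)%N ->
    normc (orbit t j x - orbit s j z) <= q / m.
  have [|x _ xP] := pull_orbit (n := n) (u := orbit s n z) qs pc (fun j _ => Hz j).
    by rewrite subrr normc0 mulr0 ltW.
  by exists x => j /xP /weight_normc; apply; rewrite ?normc_ge0.
have [|x xP] := @bolzano_weierstrass _ u (q / m + normc z).
  move=> n; have := uP n 0%N isT; have := normc_triangle (u n) z 0.
  by rewrite !subr0 /orbit /=; lra.
exists x => n; rewrite leNgt; apply/negP => h.
pose e := normc (orbit t n x - orbit s n z) - q / m.
have e0 : 0 < e by rewrite /e; lra.
have [d d0 H] := orbit_continuous t n x e0.
have [k kn kx] := xP _ d0 n.
have := H t (u k); rewrite subrr normc0 => /(_ d0 kx).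
have := uP k n kn.
have := normc_triangle (orbit t n x) (orbit t n (u k)) (orbit s n z).
rewrite (normc_distC (orbit t n x) (orbit t n (u k))) /e; lra.
Qed.

(** Since orbits that stay near the Julia set are expanded, a small disc around a point
    of such an orbit is blown up until it contains an escaping point.  Those escaping
    points are taken near the Julia set of [c], and by compactness they escape for all
    [t] near [c] simultaneously. *)
Lemma near_orbit_jset : exists r d, [/\ 0 < r, r <= r0, 0 < d &
  forall t, normc (t - c) < d -> forall z,
    (forall n, near_jset c r (orbit t n z)) -> jset t z].
Proof.
have r02 : 0 < r0 ^+ 2 by rewrite exprn_gt0.
have [q1 q10 [q11 q12]] := ex_below2 (divr_gt0 r00 (ltr0n K 2)) (divr_gt0 r02 (ltr0n K 4)).
pose q := m * q1.
have qq : q / m = q1 by rewrite /q mulrC mulKf ?gt_eqF.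
have q0 : 0 < q by rewrite mulr_gt0.
have qs : shadow_scale q by split=> //; rewrite qq; lra.
have qM : 0 < q / 2 / M by rewrite !divr_gt0.
have [r r_gt0 [rr0 rq]] := ex_below2 r00 qM.
rewrite ler_pdivlMr // in rq.
pose P y e := exists2 u, normc (u - y) < r & forall t, normc (t - c) < e -> ~ filled t u.
have [d d0 esc] : exists2 e, 0 < e & forall y, jset c y -> P y e.
  apply: (@compact_uniform _ _ P (normc c + 3)).
  - by move=> z; exact: jset_le.
  - by move=> z; exact: jset_closed.
  - by move=> z d e d0 de [u uz H]; exists u => // t td; apply: H; lra.
  move=> y [_ ny]; have r20 : 0 < r / 2 by lra.
  have [u uy nu] := ny _ r20; have [d d0 H] := not_filled_stable nu.
  have [e e0 [ed er]] := ex_below2 d0 r20.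
  exists e => // w Jw wy; exists u; last first.
    by move=> t td; apply: H; rewrite ?subrr ?normc0 //; lra.
  have := normc_triangle u y w; rewrite (normc_distC y); lra.
have [d' d'0 [d'd d'r]] := ex_below2 d0 r00.
exists r, d'; split=> // t td z Hz.
have tc : normc (t - c) < r0 by lra.
have Hz0 n : near_jset c r0 (orbit t n z) by apply: near_jset_le (Hz n).
have pc : param_close q t t.
  split; rewrite ?subrr ?normc0 ?mulr0 //; first lra.
  by apply: mulr_ge0; have := lam1; lra.
split.
  exists (normc c + 3 + r) => n; have [y Jy yn] := Hz n.
  have := jset_le Jy; have := normc_triangle (orbit t n z) y 0.
  by rewrite !subr0; lra.
move=> e e0.
have [n Hn] := ex_exp_gt q lam1 (mulr_gt0 m0 e0).
have [y Jy yn] := Hz n.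
have [u uy nu] := esc y Jy.
have /andP[b1 b2] := weight_bounds expP (Hz0 n).
have un : normc (u - orbit t n z) <= 2 * r.
  by have := normc_triangle u y (orbit t n z); rewrite (normc_distC y); lra.
have [|x xu xP] := pull_orbit (n := n) (u := u) qs pc (fun j _ => Hz0 j).
  have b1' : 0 <= rho (orbit t n z) by have := m0; lra.
  by have := ler_wpM2l b1' un; have := ler_wpM2r (ltW r_gt0) b2; lra.
exists x; last by rewrite -(filled_orbit t n) xu; apply: nu; lra.
have h : lam ^+ n * (rho z * normc (x - z)) <= q.
  apply: le_trans (xP n (leqnn n)); apply: expand_orbit => // j jn.
  split=> //; have := weight_normc (Hz0 j) (xP j (ltnW jn)) (normc_ge0 _).
  by rewrite qq; lra.
have l0 : 0 < lam ^+ n by rewrite exprn_gt0 //; have := lam1; lra.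
have /andP[b3 _] := weight_bounds expP (Hz0 0%N).
have := ler_wpM2l (ltW l0) (ler_wpM2r (normc_ge0 (x - z)) b3).
rewrite -(ltr_pM2l (mulr_gt0 l0 m0)); rewrite /orbit /=; lra.
Qed.

End Persistence.

(** * Structural stability *)

Section Conjugacy.
Variable K : realType.
Implicit Types (z w x y u s t : K[i]) (d e r q : K).

Definition shadowed kappa s t := forall z, jset s z ->
  exists2 x, jset t x & forall n, normc (orbit t n x - orbit s n z) <= kappa.

(** Expansivity made quantitative: it gives uniqueness of shadowing orbits and at the same
    time the continuity of the map that it defines. *)
Definition uniformly_expansive eta s := forall e, 0 < e -> exists n,
  forall z x, jset s z -> jset s x ->
    (forall j, (j <= n)%N -> normc (orbit s j x - orbit s j z) < eta) ->
    normc (x - z) < e.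

Lemma expansive_eq eta s z x : uniformly_expansive eta s -> jset s z -> jset s x ->
  (forall j, normc (orbit s j x - orbit s j z) < eta) -> x = z.
Proof.
move=> E Jz Jx H; apply/eqP; rewrite -subr_eq0; apply/negPn/negP => /normc_gt0 xz.
by have [n /(_ z x Jz Jx (fun j _ => H j))] := E _ xz; rewrite ltxx.
Qed.

Lemma within_continuousP (A : set K[i]) (h : K[i] -> K[i]) :
  (forall z, A z -> forall e, 0 < e -> exists2 d, 0 < d &
    forall w, A w -> normc (w - z) < d -> normc (h w - h z) < e) ->
  {within A, continuous h}.
Proof.
move=> H; apply/subspace_continuousP => z Az B /nbhs_normcP[e e0 HB].
have [d d0 Hd] := H z Az e e0; apply/nbhs_normcP; exists d => // w wd Aw.
by apply: HB; exact: Hd.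
Qed.

(** Every point is sent to the point that shadows it.  Two candidates stay within
    [2 * kappa < eta] of each other, so they agree; this uniqueness shows that the two
    maps are mutually inverse and that they commute with the dynamics. *)
Lemma conjugate_of_shadowing kappa eta s t : 2 * kappa < eta ->
  uniformly_expansive eta s -> uniformly_expansive eta t ->
  shadowed kappa s t -> shadowed kappa t s ->
  conjugate_on_julia (quad s) (quad t).
Proof.
move=> ke Es Et.
have total s' t' : shadowed kappa s' t' -> exists h : K[i] -> K[i], forall z,
    jset s' z -> jset t' (h z) /\ forall n, normc (orbit t' n (h z) - orbit s' n z) <= kappa.
  move=> sh; suff /choice[h hP] : forall z, exists x, jset s' z ->
      jset t' x /\ forall n, normc (orbit t' n x - orbit s' n z) <= kappa by exists h.
  move=> z; have [Jz|nJ] := pselect (jset s' z); last by exists 0.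
  by have [x Jx xP] := sh z Jz; exists x.
move=> /total[h hP] /total[h' h'P].
have inverse s' t' k k' : uniformly_expansive eta s' ->
    (forall z, jset s' z -> jset t' (k z) /\ forall n, normc (orbit t' n (k z) - orbit s' n z) <= kappa) ->
    (forall z, jset t' z -> jset s' (k' z) /\ forall n, normc (orbit s' n (k' z) - orbit t' n z) <= kappa) ->
    forall z, jset s' z -> k' (k z) = z.
  move=> E kP k'P z Jz; have [Jk kn] := kP z Jz; have [Jk' k'n] := k'P _ Jk.
  apply: (expansive_eq E) => // j.
  have := normc_triangle (orbit s' j (k' (k z))) (orbit t' j (k z)) (orbit s' j z).
  have := kn j; have := k'n j; lra.
have cont s' t' k : uniformly_expansive eta t' ->
    (forall z, jset s' z -> jset t' (k z) /\ forall n, normc (orbit t' n (k z) - orbit s' n z) <= kappa) ->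
    {within julia (quad s'), continuous k}.
  move=> E kP; apply: within_continuousP => z /juliaP Jz e e0.
  have [n En] := E _ e0; have gap : 0 < eta - 2 * kappa by lra.
  have [d d0 dP] : exists2 d, 0 < d & forall w, normc (w - z) < d ->
      forall j, (j <= n)%N -> normc (orbit s' j w - orbit s' j z) < eta - 2 * kappa.
    elim: (n) => [|i [d d0 IH]].
      by exists (eta - 2 * kappa) => // w wz j; rewrite leqn0 => /eqP ->.
    have [d' d'0 H] := orbit_continuous s' i.+1 z gap.
    have [d1 d10 [d1d d1d']] := ex_below2 d0 d'0.
    exists d1 => // w wz j; rewrite leq_eqVlt => /orP[/eqP ->|ji].
      by apply: H; rewrite ?subrr ?normc0 //; lra.
    by apply: IH; rewrite // (lt_le_trans wz).
  exists d => // w /juliaP Jw wz.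
  have [Jkz kz] := kP z Jz; have [Jkw kw] := kP w Jw.
  apply: En => // j jn.
  have := normc_triangle (orbit t' j (k w)) (orbit s' j w) (orbit t' j (k z)).
  have := normc_triangle (orbit s' j w) (orbit s' j z) (orbit t' j (k z)).
  rewrite (normc_distC (orbit s' j z)).
  have := kz j; have := kw j; have := dP w wz j jn; lra.
exists h, h'; split.
- exact: cont Et hP.
- exact: cont Es h'P.
- move=> z /juliaP Jz; split; first by apply/juliaP; case: (hP z Jz).
  exact: inverse Es hP h'P z Jz.
- move=> z /juliaP Jz; split; first by apply/juliaP; case: (h'P z Jz).
  exact: inverse Et h'P hP z Jz.
move=> z /juliaP Jz; rewrite !horner_quad.
have [Jh hz] := hP z Jz; have [Jhf hf] := hP _ (jset_fwd Jz).
apply: (expansive_eq Et) => //; first exact: jset_fwd.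
move=> j; rewrite -orbitSr.
have := normc_triangle (orbit t j (h (qmap s z))) (orbit s j.+1 z) (orbit t j.+1 (h z)).
have := hf j; rewrite -orbitSr => ?; have := hz j.+1.
rewrite (normc_distC (orbit s j.+1 z)); lra.
Qed.

(** Closeness [k] of shadowing is chosen first, so small that a [t]-orbit that follows
    points within [r2 / 2] of the Julia set of [c] stays within [r2] of it and so lies
    in the Julia set of [t]; the parameters are restricted afterwards. *)
Theorem structural_stability c : filled c 0 -> hyperbolic (quad c) ->
  exists2 d, 0 < d & forall t, normc (t - c) < d ->
    [/\ filled t 0, hyperbolic (quad t) & conjugate_on_julia (quad t) (quad c)].
Proof.
move=> f0 /hyperbolic_expanding[V [g [oV gV [r0 [lam [m [M expP]]]]]]].
have [r00 lam1 m0 M0 E] := expP.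
have [r2 [d2 [r20 r2r0 d20 J2]]] := near_orbit_jset expP.
have r21 : 0 < r2 / 2 by lra.
have [d1 d10 J1] := persistence expP f0 r21.
have r02 : 0 < r0 ^+ 2 by rewrite exprn_gt0.
have [k1 k10 [k1r k1r2]] := ex_below2 (divr_gt0 r00 (ltr0n K 8)) (divr_gt0 r02 (ltr0n K 4)).
have [k k0 [kk1 kr2]] := ex_below2 k10 r21.
pose q := m * k.
have qk : q / m = k by rewrite /q mulrC mulKf ?gt_eqF.
have q0 : 0 < q by rewrite mulr_gt0.
have qs : shadow_scale r0 m q by split=> //; rewrite qk; lra.
have lq : 0 < (lam - 1) * q by rewrite mulr_gt0 //; lra.
have [d3 d30 [d3r d3q]] := ex_below2 (divr_gt0 r02 (ltr0n K 4)) (divr_gt0 lq (mulr_gt0 (ltr0n K 2) M0)).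
rewrite ler_pdivlMr ?mulr_gt0 // in d3q.
have [d4 d40 [d42 d41]] := ex_below2 d20 d10.
have [d5 d50 [d54 d53]] := ex_below2 d40 d30.
have [d d0 [d5' dr]] := ex_below2 d50 r00.
have near s z : normc (s - c) < d -> jset s z -> near_jset c (r2 / 2) z.
  by move=> sd; have [|_] := J1 s; [lra|exact].
have orb s z n : jset s z -> jset s (orbit s n z).
  by move=> Jz; elim: n => // n; exact: jset_fwd.
have close s t : normc (s - c) < d -> normc (t - c) < d -> param_close c r0 lam M q s t.
  move=> sd td; have ts : normc (t - s) < 2 * d.
    by have := normc_triangle t c s; rewrite (normc_distC c s); lra.
  have := ler_wpM2l (ltW M0) (ltW ts).
  have := ler_wpM2l (ltW M0) (le_trans d5' d53).
  by split; lra.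
have expansive s : normc (s - c) < d -> uniformly_expansive r0 s.
  move=> sd e e0; have [n Hn] := ex_exp_gt (M * r0) lam1 (mulr_gt0 m0 e0).
  exists n => z x Jz Jx H.
  have sr : normc (s - c) < r0 by lra.
  have l0 : 0 < lam ^+ n * m by rewrite mulr_gt0 // exprn_gt0 //; lra.
  have := expand_orbit_bound expP (n := n) (z := z) (x := x) sr.
  move=> /(_ _)hn; rewrite -(ltr_pM2l l0) -!mulrA; apply: le_lt_trans Hn.
  apply: hn => j jn; split; last exact: H.
  by apply: near_jset_le (near s _ sd (orb _ _ j Jz)); lra.
have shadow s t : normc (s - c) < d -> normc (t - c) < d -> shadowed k s t.
  move=> sd td z Jz.
  have Hz j : near_jset c (r2 / 2) (orbit s j z) by apply: near sd _; exact: orb.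
  have [|x] := shadowing expP (z := z) qs (close s t sd td).
    by move=> j; apply: near_jset_le (Hz j); lra.
  rewrite qk => xP; exists x => //; apply: J2 => [|n]; first lra.
  by apply: near_jset_le (near_jset_trans (Hz n) (xP n)); lra.
exists d => // t td; have cd : normc (c - c) < d by rewrite subrr normc0.
have td1 : normc (t - c) < d1 by lra.
have [ft Jt] := J1 t td1.
split=> //; last first.
  by apply: (@conjugate_of_shadowing k r0); [lra|exact: expansive|exact: expansive|exact: shadow|exact: shadow].
apply: (@hyperbolic_of_expansion _ t (near_jset c r0) V g lam) => //.
- apply/open_normcP => z [y Jy zy]; exists (r0 - normc (z - y)) => [|w wz]; first lra.
  by exists y => //; have := normc_triangle w z y; lra.
- by move=> z /Jt; apply: near_jset_le; lra.
move=> z [y Jy zy].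
have [||||Vz Vw _ _ H] // := E y z z (qmap t z); first by rewrite subrr normc0.
by rewrite qmap_param; lra.
Qed.

End Conjugacy.

(** * The Julia set of a real quadratic polynomial *)

Section RealJulia.
Variable K : realType.
Implicit Types (R x beta : K) (z : K[i]).

(** Beyond [beta] the excess of the modulus over [beta] grows at least by the factor
    [1 + beta] in each step, as [r ^ 2 - R - beta = r ^ 2 - beta ^ 2 =
    (r + beta) (r - beta)]. *)
Lemma filled_le_fixpoint R beta z : 0 <= R -> 1 < beta -> beta ^+ 2 = R + beta ->
  filled (- R%:C) z -> normc z <= beta.
Proof.
move=> R0 b0 bR [M HM]; rewrite leNgt; apply/negP => zb.
have bp : 0 < normc z - beta by lra.
have l1 : 1 < 1 + beta by lra.
have grow n : (1 + beta) ^+ n * (normc z - beta) <= normc (orbit (- R%:C) n z) - beta.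
  elim: n => [|n IH]; first by rewrite expr0 mul1r.
  have : normc (orbit (- R%:C) n z) ^+ 2 - R <= normc (orbit (- R%:C) n.+1 z).
    have := normc_triangle (orbit (- R%:C) n z ^+ 2) (orbit (- R%:C) n.+1 z) 0.
    rewrite !subr0 normcX orbitS.
    have -> : orbit (- R%:C) n z ^+ 2 - qmap (- R%:C) (orbit (- R%:C) n z) = R%:C.
      by rewrite /qmap; ring.
    by rewrite normc_real ger0_norm //; lra.
  rewrite [(1 + beta) ^+ n.+1]exprS -mulrA.
  have a0 : 0 < (1 + beta) ^+ n * (normc z - beta) by rewrite mulr_gt0 // exprn_gt0 //; lra.
  set a := (1 + beta) ^+ n * _ in IH a0 *; set u := normc (orbit _ n z) in IH *.
  have : (1 + beta) * a <= (u + beta) * (u - beta) by apply: ler_pM; lra.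
  set v := normc _; lra.
have [n Hn] := ex_exp_gt M l1 bp.
have := HM n; have := grow n; lra.
Qed.

(** The image of a point of the filled Julia set has modulus at most [beta], so that
    [Re z ^ 2 >= R - beta + Im z ^ 2].  This bounds the real part from below all along
    the orbit, and forces [Im z = 0] because [Im (z ^ 2) = 2 Re z Im z]. *)
Lemma filled_real R beta z : 1 < R - beta -> 1 < beta -> beta ^+ 2 = R + beta ->
  filled (- R%:C) z ->
  complex.Im z = 0 /\ Num.sqrt (R - beta) <= `|complex.Re z| <= beta.
Proof.
move=> Rb b0 bR fz.
have R0 : 0 <= R by lra.
have sq w : filled (- R%:C) w -> R - beta <= complex.Re w ^+ 2.
  move=> fw; have := filled_le_fixpoint R0 b0 bR (proj2 (filled_qmap _ _) fw).
  move=> /(le_trans (normc_Re_le _)); rewrite ler_norml => /andP[+ _].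
  case: w {fw} => a b; rewrite /qmap /= !expr2 /=; have := sqr_ge0 b; rewrite expr2; nra.
have im0 : complex.Im z = 0.
  apply/eqP/negPn/negP => /eqP nz.
  have grow n : 4 ^+ n * complex.Im z ^+ 2 <= complex.Im (orbit (- R%:C) n z) ^+ 2.
    elim: n => [|n IH]; first by rewrite expr0 mul1r.
    have := sq _ (proj2 (filled_orbit _ n _) fz).
    rewrite orbitS [4 ^+ n.+1]exprS /qmap; case: (orbit _ _ _) IH => a b /= IH ha.
    have -> : a * b + b * a + - 0 = 2 * (a * b) by ring.
    have := ler_wpM2r (sqr_ge0 b) (le_trans (ltW Rb) ha).
    rewrite !exprMn; lra.
  have i0 : 0 < complex.Im z ^+ 2 by rewrite exprn_even_gt0 //=; apply/eqP.
  have l4 : 1 < 4 :> K by lra.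
  have [n Hn] := ex_exp_gt (beta ^+ 2) l4 i0.
  have := filled_le_fixpoint R0 b0 bR (proj2 (filled_orbit _ n _) fz).
  have := normc_Im_le (orbit (- R%:C) n z); have := grow n.
  rewrite -[complex.Im (orbit _ _ _) ^+ 2]real_normK ?num_real //.
  have := normr_ge0 (complex.Im (orbit (- R%:C) n z)); nra.
split=> //; apply/andP; split.
  by rewrite -sqrtr_sqr ler_wsqrtr // sq.
exact: le_trans (normc_Re_le z) (filled_le_fixpoint R0 b0 bR fz).
Qed.

End RealJulia.

(** * The skew product *)

Section Assembly.
Variable K : realType.

Lemma small_segment_component (c : K[i]) (d : K) :
  (forall t : K, 0 <= t <= d -> @hyperbolic_locus K (c + t%:C)) ->
  forall t, 0 <= t <= d -> connected_component (@hyperbolic_locus K) c (c + t%:C).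
Proof.
move=> H t t01.
have d0 : 0 <= d by case/andP: t01; exact: le_trans.
apply: (@connected_component_max _ _ ((fun t : K => c + t%:C) @` `[0, d])).
- by exists 0 => /=; rewrite ?addr0 // in_itv /= lexx.
- by move=> _ [x /= xd <-]; apply: H; rewrite in_itv in xd.
- apply: connected_continuous_connected; first exact: segment_connected.
  apply: continuous_subspaceT => x A /nbhs_normcP[e e0 HA].
  apply/nbhs_ballP; exists e => //= y; rewrite -ball_normE /= distrC => xy.
  apply: HA; rewrite opprD addrACA subrr add0r -rmorphB normc_real //.
by exists t => //=; rewrite in_itv.
Qed.

End Assembly.
Theorem proposition3p1 (K : realType) (c : K[i])
    (c_in_M : mandelbrot c) (c_hyp : hyperbolic (quad c)) :
  exists (a : K[i]) (R S : K),
    [/\ 6 < R, 0 < S &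
    let p : {poly K[i]} := 'X^2 - (R%:C)%:P in
    let param (z : K[i]) : K[i] := c + (z + a) / S%:C in
    let q (z : K[i]) : {poly K[i]} := quad (param z) in
    exists alpha beta : K,
      [/\ alpha < 0, 0 < beta,
        (forall x : K[i], p.[x] = x <-> x = alpha%:C \/ x = beta%:C) &
      let eta : K := Num.sqrt (R - beta) in
      let D1 : set K[i] := [set x%:C | x in `[- beta, - eta]] in
      let D2 : set K[i] := [set - z | z in D1] in
      [/\ julia p `<=` D1 `|` D2,
          (exists W : set K[i],
            [/\ hyperbolic_component W, W c &
              forall z, D1 z ->
                W (param z) /\ conjugate_on_julia (q z) (quad c)])
        & forall z, D2 z -> ~ mandelbrot (param z)]]].
Proof.
have f0 : filled c 0 by exact/mandelbrotP.
have [d d0 stable] := structural_stability f0 c_hyp.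
(* [S] keeps the parameters over [D1] within [2 / S = d / 2] of [c]. *)
have [S S0 dS] : exists2 S : K, 0 < S & d / 2 * S = 2.
  by exists (4 / d); [rewrite divr_gt0|field; rewrite gt_eqF].
(* [beta] puts the parameters over [D2] outside the disc of radius [3]; [R] is then the
   value for which [beta] is a fixed point. *)
have [beta b4 bS] : exists2 beta : K, 4 <= beta & S * (normc c + 3) <= beta.
  exists (4 + S * (normc c + 3)); last by lra.
  by rewrite lerDl mulr_ge0 ?(ltW S0) //; have := normc_ge0 c; lra.
pose R := beta ^+ 2 - beta.
have bR : beta ^+ 2 = R + beta by rewrite subrK.
have R12 : 12 <= R by rewrite /R; nra.
have Rb : 1 < R - beta by rewrite /R; nra.
exists beta%:C, R, S; split=> //; first lra.
move=> p param q; exists (1 - beta), beta; split; [lra|lra| |].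
  move=> x; have -> : p.[x] = x ^+ 2 - R%:C by rewrite /p !hornerE.
  have RC : R%:C = beta%:C ^+ 2 - beta%:C by rewrite rmorphB rmorphXn.
  split=> [h|[] ->]; last 2 first.
  - by rewrite RC rmorphB rmorph1; ring.
  - by rewrite RC; ring.
  have : (x - (1 - beta)%:C) * (x - beta%:C) == 0.
    rewrite rmorphB rmorph1; apply/eqP.
    rewrite (_ : _ * _ = x ^+ 2 - (beta%:C ^+ 2 - beta%:C) - x); last by ring.
    by rewrite -RC h subrr.
  by rewrite mulf_eq0 !subr_eq0 => /orP[] /eqP; [left|right].
move=> eta D1 D2.
have eta0 : 0 <= eta by exact: sqrtr_ge0.
have eta2 : eta ^+ 2 = R - beta by rewrite sqr_sqrtr //; lra.
have pq : p = quad (- R%:C) by rewrite /p /quad polyCN.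
have param_real (x : K) : param x%:C = c + ((x + beta) / S)%:C.
  by rewrite /param [in RHS]rmorphM rmorphD fmorphV.
split.
- move=> z; rewrite pq => /juliaP[/(filled_real Rb _ bR)]; case; first lra.
  case: z => a b /= -> /andP[ha hb] _.
  have [a0|a0] := leP 0 a; [right|left].
    exists (- a%:C); rewrite ?opprK //; exists (- a); rewrite ?rmorphN //= in_itv /=.
    by rewrite ger0_norm // in ha hb; rewrite !lerN2 hb; exact: ha.
  exists a => //=; rewrite in_itv /=.
  rewrite ltr0_norm // in ha hb; rewrite -/eta in ha.
  by apply/andP; split; lra.
- have loc (t : K) : 0 <= t <= d / 2 -> [/\ filled (c + t%:C) 0,
      hyperbolic (quad (c + t%:C)) & conjugate_on_julia (quad (c + t%:C)) (quad c)].
    move=> /andP[t0 td]; apply: stable.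
    by rewrite addrC addKr normc_real ger0_norm //; lra.
  have locus (t : K) : 0 <= t <= d / 2 -> @hyperbolic_locus K (c + t%:C).
    by move=> /loc[ft ht _]; split=> //; exact/mandelbrotP.
  exists (connected_component (@hyperbolic_locus K) c); split.
  + by exists c.
  + have h : (0 : K) <= 0 <= d / 2 by rewrite lexx /=; lra.
    by have := small_segment_component locus h; rewrite addr0.
  move=> _ [x /= xD <-]; rewrite in_itv /= in xD; have /andP[x1 x2] := xD.
  have t01 : 0 <= (x + beta) / S <= d / 2.
    (* [(beta - eta) * (beta + eta) = 2 * beta]. *)
    have be : beta - eta <= 2 by nra.
    apply/andP; split; first by rewrite divr_ge0 ?(ltW S0) //; lra.
    by rewrite ler_pdivrMr // dS; lra.
  rewrite /q param_real; split; first exact: small_segment_component locus _ t01.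
  by have [] := loc _ t01.
move=> _ [_ [x /= xD <-] <-] /mandelbrotP; rewrite in_itv /= in xD.
have /andP[x1 x2] := xD.
rewrite -rmorphN param_real; set c' := c + _.
rewrite -filled_qmap /qmap expr0n add0r.
have c'3 : 3 <= normc c'.
  have : normc c + 3 <= (- x + beta) / S.
    by rewrite ler_pdivlMr // mulrC; lra.
  have b0 : 0 <= (- x + beta) / S by rewrite divr_ge0 ?(ltW S0) //; lra.
  have := le_normcD c' (- c).
  rewrite normcN /c' addrC addKr normc_real ger0_norm //; lra.
exact: escape.
Qed.
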